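(* Let $n\ge 1$ and let $W_1,\dots,W_r\in\{\mathbb 1,\sigma_x,\sigma_y,\sigma_z\}^{\otimes n}$ be pairwise distinct non-identity $n$-qubit Pauli strings, with active neighborhoods $\mathcal N(j)$, $j\in[n]$, and active-neighborhood graph $\mathcal G_{\mathcal N}$ with chromatic number $\chi(\mathcal G_{\mathcal N})$. Put $\alpha^{\mathrm{loc}}=\max_{j\in[n]}|\mathcal N(j)|$, the worst-case number of local product-state probes used to make the local reconstruction matrices full column rank at the initial time $t_0=0$. Then there exists a set $\mathcal S=\{\rho_s\}_{s\in[|\mathcal S|]}$ of separable $n$-qubit states (global separable probe configurations) satisfying $$|\mathcal S|\le \chi(\mathcal G_{\mathcal N})\,\alpha^{\mathrm{loc}}$$ such that all local inverse problems are solvable at the initial time, i.e. for every $j\in[n]$ the local reconstruction matrix $\mathsf M_j^{\mathrm{loc}}(t_0)$ built from the probe states $\rho_s(t_0)=\rho_s$ has full column rank.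
   Context: Notation: $[n]=\{1,\dots,n\}$. $Z_j=\mathbb 1^{\otimes (j-1)}\otimes\sigma_z\otimes\mathbb 1^{\otimes(n-j)}$ is the Pauli $\sigma_z$ on qubit $j$. For a Pauli string $W$, $\operatorname{supp}(W)\subseteq[n]$ is the set of qubits on which $W$ acts nontrivially. The active neighborhood of site $j\in[n]$ is $\mathcal N(j)=\{W_m : [Z_j,W_m]\neq 0\}$ (the given Pauli strings whose tensor factor at site $j$ is $\sigma_x$ or $\sigma_y$). Its physical support is $\operatorname{supp}\mathcal N(j)=\bigcup_{W_m\in\mathcal N(j)}\operatorname{supp}(W_m)$. The active-neighborhood graph $\mathcal G_{\mathcal N}$ has one vertex $\mathcal N(j)$ for each $j\in[n]$, and for $j\ne k$ the vertices $\mathcal N(j),\mathcal N(k)$ are joined by an edge if and only if $\operatorname{supp}\mathcal N(j)\cap\operatorname{supp}\mathcal N(k)\neq\varnothing$. Its chromatic number $\chi(\mathcal G_{\mathcal N})$ is the minimum number of colors in a proper vertex coloring. Given probe states $\rho_1,\dots,\rho_S$, the local reconstruction matrix of site $j$ at time $t_0$ is the real $S\times|\mathcal N(j)|$ matrix with entries $$(\mathsf M_j^{\mathrm{loc}}(t_0))_{sm}=-i\,\mathrm{Tr}\big([Z_j,W_m]\rho_s\big),\qquad s\in[S],\ W_m\in\mathcal N(j).$$ The local inverse problem at site $j$ (recovering the coefficients $\mu_m$ with $W_m\in\mathcal N(j)$ from $\mathsf M_j^{\mathrm{loc}}(t_0)\boldsymbol\mu_{\mathcal N(j)}$) is called solvable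 when this matrix has full column rank $|\mathcal N(j)|$. *)

(* Defs.v *)
From HB Require Import structures.
From mathcomp Require Import all_boot all_order all_algebra.
From mathcomp Require Import reals.
From mathcomp Require Import complex mxtens.

Set Implicit Arguments.
Unset Strict Implicit.
Unset Printing Implicit Defensive.

Import Order.TTheory GRing.Theory Num.Theory.
Local Open Scope ring_scope.
Local Open Scope complex_scope.
Local Open Scope sesquilinear_scope.

Record sgraph (V : finType) := SGraph {
  adj :> rel V;
  adj_sym : symmetric adj;
  adj_irr : irreflexive adj }.

Definition proper_coloring (V : finType) (G : sgraph V) (k : nat)
    (c : {ffun V -> 'I_k}) : bool :=
  [forall x, forall y, G x y ==> (c x != c y)].

Definition colorable (V : finType) (G : sgraph V) (k : nat) : bool :=
  [exists c : {ffun V -> 'I_k}, proper_coloring G c].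

Lemma ex_colorable (V : finType) (G : sgraph V) : exists k, colorable G k.
Proof.
exists #|V|; apply/existsP; exists [ffun x => enum_rank x].
apply/forallP=> x; apply/forallP=> y; apply/implyP=> Gxy; rewrite !ffunE.
by apply: contraTneq Gxy => /enum_rank_inj->; rewrite adj_irr.
Qed.

Definition chromatic_number (V : finType) (G : sgraph V) : nat :=
  ex_minn (ex_colorable G).

Section IntersectionGraph.
Variables (V T : finType) (F : V -> {set T}).

Definition meet_adj : rel V :=
  fun x y => (x != y) && (F x :&: F y != set0).

Lemma meet_adj_sym : symmetric meet_adj.
Proof. by move=> x y; rewrite /meet_adj eq_sym setIC. Qed.

Lemma meet_adj_irr : irreflexive meet_adj.
Proof. by move=> x; rewrite /meet_adj eqxx. Qed.

Definition intersection_graph : sgraph V := SGraph meet_adj_sym meet_adj_irr.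

End IntersectionGraph.

Inductive pauli := PI | PX | PY | PZ.

Definition pauli_code (p : pauli) : bool * bool :=
  match p with
  | PI => (false, false) | PX => (true, false)
  | PY => (true, true)   | PZ => (false, true)
  end.

Definition pauli_decode (b : bool * bool) : pauli :=
  match b with
  | (false, false) => PI | (true, false) => PX
  | (true, true) => PY   | (false, true) => PZ
  end.

Lemma pauli_codeK : cancel pauli_code pauli_decode.
Proof. by case. Qed.

HB.instance Definition _ := Finite.copy pauli (can_type pauli_codeK).

Definition pauli_string (n : nat) : finType := {ffun 'I_n -> pauli}.

Definition id_string (n : nat) : pauli_string n := [ffun=> PI].

Definition supp (n : nat) (P : pauli_string n) : {set 'I_n} :=
  [set k | P k != PI].

(* The dimension 2 ^ n, in a form for which hdim n.+1 is convertible to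
   2 * hdim n, so that no cast is needed in [tens]. *)
Definition hdim (n : nat) : nat := iter n (muln 2) 1%N.

Lemma hdimE (n : nat) : hdim n = (2 ^ n)%N.
Proof. by elim: n => //= n IHn; rewrite expnS -IHn. Qed.

(* A_0 (x) A_1 (x) ... (x) A_(n-1), with qubits numbered from 0. *)
Fixpoint tens (K : pzRingType) (n : nat) :
    ('I_n -> 'M[K]_2) -> 'M[K]_(hdim n) :=
  match n with
  | 0 => fun=> 1%:M
  | n'.+1 => fun A => A ord0 *t tens (fun k : 'I_n' => A (lift ord0 k))
  end.

Definition commutator (K : pzRingType) (d : nat) (A B : 'M[K]_d) : 'M[K]_d :=
  A *m B - B *m A.

Section Quantum.
Variable R : realType.
Local Notation C := (R[i]).

Definition sigma_x : 'M[C]_2 := \matrix_(a, b) (a != b)%:R.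

Definition sigma_y : 'M[C]_2 :=
  \matrix_(a, b) (if (a < b)%N then - 'i else if (b < a)%N then 'i else 0).

Definition sigma_z : 'M[C]_2 :=
  \matrix_(a, b) (if a == b then (-1) ^+ a else 0).

Definition pauli_mx (p : pauli) : 'M[C]_2 :=
  match p with
  | PI => 1%:M | PX => sigma_x | PY => sigma_y | PZ => sigma_z
  end.

Definition string_mx (n : nat) (P : pauli_string n) : 'M[C]_(hdim n) :=
  tens (fun k => pauli_mx (P k)).

Definition Zop (n : nat) (j : 'I_n) : 'M[C]_(hdim n) :=
  tens (fun k => if k == j then sigma_z else 1%:M).

Definition density (d : nat) (A : 'M[C]_d) : Prop :=
  [/\ A ^t* = A,
      forall v : 'cV[C]_d, 0 <= (v ^t* *m A *m v) 0 0
    & \tr A = 1].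

Definition separable (n : nat) (A : 'M[C]_(hdim n)) : Prop :=
  exists (K : nat) (p : 'I_K -> R) (q : 'I_K -> 'I_n -> 'M[C]_2),
    [/\ forall l, 0 <= p l,
        \sum_l p l = 1,
        forall l k, density (q l k)
      & A = \sum_l (p l)%:C *: tens (q l)].

Definition active_nbhd (n r : nat) (W : 'I_r -> pauli_string n) (j : 'I_n) :
    {set pauli_string n} :=
  [set P in codom W | commutator (Zop j) (string_mx P) != 0].

Definition nbhd_supp (n r : nat) (W : 'I_r -> pauli_string n) (j : 'I_n) :
    {set 'I_n} :=
  \bigcup_(P in active_nbhd W j) supp P.

(* The vertex of site j is j itself, so sites with equal active neighborhoods
   remain distinct vertices. *)
Definition nbhd_graph (n r : nat) (W : 'I_r -> pauli_string n) : sgraph 'I_n :=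
  intersection_graph (nbhd_supp W).

Definition alpha_loc (n r : nat) (W : 'I_r -> pauli_string n) : nat :=
  \max_(j < n) #|active_nbhd W j|.

Definition local_entry (n : nat) (j : 'I_n) (P : pauli_string n)
    (A : 'M[C]_(hdim n)) : C :=
  - 'i * \tr (commutator (Zop j) (string_mx P) *m A).

(* The entries are real on states: see [local_entry_real]. *)
Definition local_matrix (n r : nat) (W : 'I_r -> pauli_string n) (S : nat)
    (rho : 'I_S -> 'M[C]_(hdim n)) (j : 'I_n) :
    'M[R]_(S, #|active_nbhd W j|) :=
  \matrix_(s, m) complex.Re (local_entry j (enum_val m) (rho s)).

Definition locally_solvable (n r : nat) (W : 'I_r -> pauli_string n) (S : nat)
    (rho : 'I_S -> 'M[C]_(hdim n)) (j : 'I_n) : Prop :=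
  \rank (local_matrix W rho j) = #|active_nbhd W j|.

Lemma adj_tens (n : nat) (A : 'I_n -> 'M[C]_2) :
  (tens A) ^t* = tens (fun k => (A k) ^t*).
Proof.
elim: n A => [|n IHn] A; first by rewrite /= trmx1 map_mx1.
by rewrite /= trmx_tens map_mxT -IHn.
Qed.

Lemma eq_tens (n : nat) (A B : 'I_n -> 'M[C]_2) : A =1 B -> tens A = tens B.
Proof.
by elim: n A B => //= n IHn A B eqAB; rewrite eqAB (IHn _ (B \o lift ord0)).
Qed.

Lemma adj_pauli (p : pauli) : (pauli_mx p) ^t* = pauli_mx p.
Proof.
case: p => /=; first by rewrite trmx1 map_mx1.
- by apply/matrixP=> a b; rewrite !mxE conjC_nat eq_sym.
- apply/matrixP=> a b; rewrite !mxE.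
  by case: ltngtP => _; apply/eqP; rewrite eq_complex /= ?oppr0 ?opprK !eqxx.
- apply/matrixP=> a b; rewrite !mxE eq_sym.
  by case: eqP => [->|_]; rewrite ?conjC0 // rmorphXn rmorphN1.
Qed.

Lemma adj_string (n : nat) (P : pauli_string n) :
  (string_mx P) ^t* = string_mx P.
Proof. by rewrite adj_tens; apply: eq_tens => k; exact: adj_pauli. Qed.

Lemma adj_Zop (n : nat) (j : 'I_n) : (Zop j) ^t* = Zop j.
Proof.
rewrite adj_tens; apply: eq_tens => k.
by case: eqP => _; [exact: (adj_pauli PZ) | exact: (adj_pauli PI)].
Qed.

Lemma adj_separable (n : nat) (A : 'M[C]_(hdim n)) : separable A -> A ^t* = A.
Proof.
move=> [K [p [q [_ _ dq ->]]]]; rewrite raddf_sum raddf_sum /=.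
apply: eq_bigr => l _; rewrite linearZ /= map_mxZ adj_tens; congr (_ *: _).
  by apply/eqP; rewrite eq_complex /= oppr0 !eqxx.
by apply: eq_tens => k; case: (dq l k).
Qed.

Lemma local_entry_real (n : nat) (j : 'I_n) (P : pauli_string n)
    (A : 'M[C]_(hdim n)) :
  separable A -> (complex.Re (local_entry j P A))%:C = local_entry j P A.
Proof.
move=> /adj_separable hA.
have adjM (B D : 'M[C]_(hdim n)) : (B *m D) ^t* = D ^t* *m B ^t*.
  by rewrite trmx_mul map_mxM.
rewrite /local_entry; set X := commutator _ _.
have hX : X ^t* = - X.
  by rewrite /X /commutator linearB /= map_mxB !adjM adj_string adj_Zop opprB.
have tr_adj (B : 'M[C]_(hdim n)) : \tr (B ^t*) = (\tr B)^*%C.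
  by rewrite trace_map_mx mxtrace_tr.
have := tr_adj (X *m A).
rewrite adjM hX hA mulmxN raddfN /= mxtrace_mulC => /esym.
case: (\tr _) => x y /eqP; rewrite eq_complex /= => /andP[/eqP hx _].
have x0 : x = 0.
  by apply/eqP; rewrite -[_ == 0](@mulrn_eq0 _ x 2) mulr2n {1}hx addNr.
by apply/eqP; rewrite eq_complex /= x0 !(mul0r, mulr0, oppr0, addr0) !eqxx.
Qed.

End Quantum.

(* Main.v *)
(** On the active neighborhood of site j, [Z_j, W] is a nonzero imaginary multiple
    of the Pauli string W' obtained from W by exchanging x and y at site j, so the
    local entry of W on rho is, up to sign, twice Tr (W' rho).  For a Pauli string
    Q distinct from the identity, 2^-n (1 + Q) is a separable state whose
    expectation of a non-identity Pauli string is 1 on Q and 0 on all others.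
    Given a proper coloring, a color a and an index t, the probe is the uniform
    mixture over the sites k of these states, where Q is the string W' of the t-th member
    of N(k) if k has color a and such a member exists, and where Q is dropped
    otherwise.  Sites of one color have disjoint neighborhood supports, so each
    site only sees its own Q, and its t-th probe yields a multiple of the t-th
    unit row. *)
Require Import Defs.
From mathcomp Require Import all_boot all_order all_algebra.
From mathcomp Require Import reals complex.
From mathcomp Require Import mxtens ring.

Set Implicit Arguments.
Unset Strict Implicit.
Unset Printing Implicit Defensive.

Import Order.TTheory GRing.Theory Num.Theory.
Local Open Scope ring_scope.
Local Open Scope complex_scope.
Local Open Scope sesquilinear_scope.

(** * Two-valued indices and a full-rank criterion *)

Lemma sum_ord2 (V : nmodType) (f : 'I_2 -> V) :
  \sum_i f i = f 0 + f 1.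
Proof.
rewrite big_ord_recl big_ord1; congr (f _ + f _).
exact: val_inj.
Qed.

Lemma ord2P (P : 'I_2 -> Prop) : P 0 -> P 1 -> forall a, P a.
Proof.
move=> P0 P1 [[|[|//]] h].
  by rewrite (_ : Ordinal h = 0) //; apply: val_inj.
by rewrite (_ : Ordinal h = 1) //; apply: val_inj.
Qed.

(** Every unit row lies in the row space, which is then everything; the remaining rows are
    arbitrary. *)
Lemma row_full_diag (F : fieldType) (m n : nat) (A : 'M[F]_(m, n)) :
  (forall i, exists s (c : F), c != 0 /\ row s A = c *: delta_mx 0 i) ->
  row_full A.
Proof.
move=> hA; rewrite -sub1mx; apply/row_subP => i; rewrite row1.
have [s [c [c0 rs]]] := hA i.
by rewrite -[delta_mx 0 i](scalerK c0) -rs scalemx_sub ?row_sub.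
Qed.

(** * Entries, traces and multilinearity of tensor products *)

Section Tens.
Variable K : comPzRingType.

(** Binary digits of a basis index, the leading one belonging to qubit 0. *)
Fixpoint digit (n : nat) : 'I_(hdim n) -> 'I_n -> 'I_2 :=
  match n return 'I_(hdim n) -> 'I_n -> 'I_2 with
  | 0 => fun _ _ => ord0
  | n'.+1 => fun i k =>
      let ij := mxtens_unindex (i : 'I_(2 * hdim n')) in
      if unlift ord0 k is Some k' then digit ij.2 k' else ij.1
  end.

Lemma tensE (n : nat) (A : 'I_n -> 'M[K]_2) i j :
  tens A i j = \prod_k A k (digit i k) (digit j k).
Proof.
elim: n A i j => [|n IHn] A i j; first by rewrite big_ord0 (ord1 i) (ord1 j) mxE.
rewrite big_ord_recl /= mxE unlift_none IHn; congr (_ * _).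
by apply: eq_bigr => k _; rewrite liftK.
Qed.

Lemma tens_mul (n : nat) (A B : 'I_n -> 'M[K]_2) :
  tens A *m tens B = tens (fun k => A k *m B k).
Proof. by elim: n A B => [|n IHn] A B /=; rewrite ?mulmx1 // tensmx_mul IHn. Qed.

Lemma tr_tens (n : nat) (A : 'I_n -> 'M[K]_2) :
  \tr (tens A) = \prod_k \tr (A k).
Proof.
elim: n A => [|n IHn] A /=; first by rewrite big_ord0 mxtrace1.
rewrite big_ord_recl -IHn /mxtrace mulr_sum.
by apply: eq_bigr => i _; rewrite mxE.
Qed.

Lemma tens_scale (n : nat) (c : 'I_n -> K) (A : 'I_n -> 'M[K]_2) :
  tens (fun k => c k *: A k) = (\prod_k c k) *: tens A.
Proof.
apply/matrixP=> i j; rewrite mxE !tensE -big_split.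
by apply: eq_bigr => k _; rewrite mxE.
Qed.

Lemma tens_sum (n : nat) (J : finType) (A : 'I_n -> J -> 'M[K]_2) :
  tens (fun k => \sum_b A k b)
  = \sum_(f : {ffun 'I_n -> J}) tens (fun k => A k (f k)).
Proof.
apply/matrixP=> i j; rewrite summxE tensE.
under eq_bigr do rewrite summxE.
by rewrite bigA_distr_bigA; apply: eq_bigr => f _; rewrite tensE.
Qed.

End Tens.

(** * Multiplication of Pauli letters by sigma_z, up to phase *)

Definition mulZ (p : pauli) : pauli :=
  match p with PI => PZ | PZ => PI | PX => PY | PY => PX end.

Definition flips (p : pauli) : bool := (p == PX) || (p == PY).

Lemma mulZK : involutive mulZ. Proof. by case. Qed.

Lemma mulZ_eqI (p : pauli) : flips p -> (mulZ p == PI) = (p == PI).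
Proof. by case: p. Qed.

Definition mulZ_at (n : nat) (j : 'I_n) (P : pauli_string n) : pauli_string n :=
  [ffun k => if k == j then mulZ (P k) else P k].

Lemma mulZ_atK (n : nat) (j : 'I_n) : involutive (mulZ_at j).
Proof.
move=> P; apply/ffunP => k; rewrite !ffunE.
by case: (k =P j) => // _; rewrite mulZK.
Qed.

Lemma supp_mulZ_at (n : nat) (j : 'I_n) (P : pauli_string n) :
  flips (P j) -> supp (mulZ_at j P) = supp P.
Proof.
move=> Pj; apply/setP => k; rewrite !inE ffunE.
by case: (k =P j) => // ->; rewrite mulZ_eqI.
Qed.

(** * Commutators with Z_j *)

Section Quantum.
Variable R : realType.
Local Notation C := (R[i]).
Local Notation mx := (pauli_mx R).
Local Notation smx := (string_mx R).

(** The scalar c with sigma_z p = c [mulZ p]; by taking adjoints, p sigma_z carries the conjugate of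
    c. *)
Definition Zphase (p : pauli) : C :=
  match p with PX => 'i | PY => - 'i | _ => 1 end.

Local Ltac pauli_entries :=
  rewrite ?mxE !sum_ord2 !mxE ?sum_ord2 ?mxE /=; apply/eqP;
  rewrite eq_complex /=; apply/andP; split; apply/eqP; ring.

Local Ltac pauli_matrix := apply/matrixP; apply: ord2P; apply: ord2P;
  pauli_entries.

Lemma sigma_z_mul (p : pauli) : sigma_z R *m mx p = Zphase p *: mx (mulZ p).
Proof. by case: p; pauli_matrix. Qed.

Lemma mul_sigma_z (p : pauli) :
  mx p *m sigma_z R = (Zphase p)^*%C *: mx (mulZ p).
Proof. by case: p; pauli_matrix. Qed.

Lemma tr_pauli_mul (p q : pauli) : \tr (mx p *m mx q) = 2 * (p == q)%:R.
Proof. by case: p; case: q; rewrite /mxtrace; pauli_entries. Qed.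

Lemma pauli_sqr (p : pauli) : mx p *m mx p = 1%:M.
Proof. by case: p; pauli_matrix. Qed.

Lemma tr_pauli (p : pauli) : \tr (mx p) = 2 * (p == PI)%:R.
Proof. by rewrite -tr_pauli_mul /= mulmx1. Qed.

Lemma commutator_Zop (n : nat) (j : 'I_n) (P : pauli_string n) :
  commutator (Zop R j) (smx P)
  = (Zphase (P j) - (Zphase (P j))^*%C) *: smx (mulZ_at j P).
Proof.
(* The phase occurs at site j only; written as a product over all sites, it moves into the factors
   by [tens_scale]. *)
have prod_at (c : C) : \prod_(k < n) (if k == j then c else 1) = c.
  by rewrite -big_mkcond big_pred1_eq.
rewrite /commutator !tens_mul scalerBl; congr (_ - _).
  rewrite -{1}(prod_at (Zphase (P j))) -tens_scale; apply: eq_tens => k.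
  rewrite ffunE; case: eqP => [->|_]; first exact: sigma_z_mul.
  by rewrite mul1mx scale1r.
rewrite -(prod_at (Zphase (P j))^*%C) -tens_scale; apply: eq_tens => k.
rewrite ffunE; case: eqP => [->|_]; first exact: mul_sigma_z.
by rewrite mulmx1 scale1r.
Qed.

Lemma active_flips (n r : nat) (W : 'I_r -> pauli_string n) j P :
  P \in active_nbhd R W j -> flips (P j).
Proof.
rewrite inE commutator_Zop => /andP[_]; apply: contraR.
by case: (P j) => // _; rewrite /Zphase conjc1 subrr scale0r.
Qed.

(** * Trace orthogonality and correlated states *)

Lemma tr_string_mul (n : nat) (P Q : pauli_string n) :
  \tr (smx P *m smx Q) = 2 ^+ n * (P == Q)%:R.
Proof.
rewrite tens_mul tr_tens; under eq_bigr do rewrite tr_pauli_mul.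
rewrite big_split prodr_const card_ord; congr (_ * _).
case: eqP => [->|nePQ]; first by rewrite big1 // => k _; rewrite eqxx.
have [k nek] : exists k, P k != Q k.
  apply/existsP; apply: contra_notT nePQ => /existsPn eqPQ.
  by apply/ffunP => k; apply/eqP; move: (eqPQ k); rewrite negbK.
by rewrite (bigD1 k) //= (negPf nek) mul0r.
Qed.

(** [None] encodes a dropped string and gives the maximally mixed state. The identity is written as
    a Pauli string so that [tr_string_mul] covers it. *)
Definition corr_state (n : nat) (o : option (pauli_string n)) :
    'M[C]_(hdim n) :=
  (2^-1) ^+ n *: (smx (id_string n) + oapp (@string_mx R n) 0 o).

Lemma tr_corr_state (n : nat) (P : pauli_string n) o : P != id_string n ->
  \tr (smx P *m corr_state o) = (o == Some P)%:R.
Proof.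
move=> Pid; rewrite -scalemxAr mxtraceZ mulmxDr mxtraceD tr_string_mul.
have h2 : (2^-1) ^+ n * 2 ^+ n = 1 :> C.
  by rewrite -exprMn mulVf ?expr1n // pnatr_eq0.
rewrite (negPf Pid) mulr0 add0r; case: o => [Q|] /=.
  by rewrite tr_string_mul mulrA h2 mul1r eq_sym.
by rewrite mulmx0 mxtrace0 mulr0.
Qed.

(** * Decomposition of correlated states into product states *)

Lemma separable_sum (n : nat) (I : finType) (p : I -> R)
    (q : I -> 'I_n -> 'M[C]_2) :
  (forall l, 0 <= p l) -> \sum_l p l = 1 -> (forall l k, density (q l k)) ->
  separable (\sum_l (p l)%:C *: tens (q l)).
Proof.
move=> p0 p1 dq; exists #|I|, (p \o enum_val), (q \o enum_val); split => //=.
  by rewrite -p1 [RHS](reindex _ (onW_bij _ (enum_val_bij I))).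
by rewrite (reindex _ (onW_bij _ (enum_val_bij I))).
Qed.

(** For p other than the identity, the projector onto the eigenvector of p with eigenvalue
    (-1)^b. *)
Definition eigenstate (p : pauli) (b : bool) : 'M[C]_2 :=
  2^-1 *: (1%:M + (-1) ^+ b *: mx p).

Lemma eigenstate_density (p : pauli) (b : bool) :
  p != PI -> density (eigenstate p b).
Proof.
move=> pI; have two0 : (2 : C) != 0 by rewrite pnatr_eq0.
have herm : (eigenstate p b) ^t* = eigenstate p b.
  rewrite /eigenstate linearZ /= map_mxZ linearD /= map_mxD trmx1 map_mx1.
  rewrite linearZ /= map_mxZ adj_pauli; congr (_ *: (_ + _ *: _)).
    by rewrite fmorphV rmorph_nat.
  by rewrite rmorphXn rmorphN1.
have idem : eigenstate p b *m eigenstate p b = eigenstate p b.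
  rewrite /eigenstate; set U := (-1) ^+ b *: mx p.
  have UU : U *m U = 1%:M.
    by rewrite -scalemxAl -scalemxAr pauli_sqr scalerA -expr2 sqrr_sign scale1r.
  rewrite -scalemxAl -scalemxAr mulmxDl !mulmxDr !mul1mx mulmx1 UU.
  rewrite [U + _]addrC -mulr2n -[(_ + U) *+ 2]scaler_nat.
  by rewrite !scalerA -mulrA mulVf ?mulr1.
split=> //.
  (* The quadratic form of a Hermitian idempotent E at v is the squared norm of E v. *)
  move=> v; rewrite -idem -{1}herm !mulmxA -mulmxA.
  set w := _ *m v; rewrite (_ : _ *m _ = w ^t* *m w).
    rewrite mxE sumr_ge0 // => i _; rewrite !mxE mulrC; exact: mul_conjC_ge0.
  by rewrite /w trmx_mul map_mxM.
rewrite mxtraceZ mxtraceD mxtrace1 mxtraceZ tr_pauli (negPf pI) !mulr0 addr0.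
by rewrite mulVf.
Qed.

(* Identity factors are diagonalized by sigma_z, and their sign is ignored. *)
Definition basis (p : pauli) : pauli := if p == PI then PZ else p.

Definition sgn (p : pauli) (b : bool) : R := if p == PI then 1 else (-1) ^+ b.

Lemma real_half : (2^-1)%:C = 2^-1 :> C.
Proof. by rewrite fmorphV rmorph_nat. Qed.

Lemma eigenstate_mean (p : pauli) :
  \sum_b (2^-1)%:C *: eigenstate p b = 2^-1 *: 1%:M.
Proof.
rewrite big_bool /= real_half -scalerDr; congr (_ *: _).
rewrite -scalerDr expr1 expr0 scaleN1r scale1r addrACA addNr addr0.
by rewrite -mulr2n -[1%:M *+ 2]scaler_nat scalerA mulVf ?scale1r ?pnatr_eq0.
Qed.

(** Half the spectral decomposition of p; on the identity letter the constant sign gives the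
    resolution of the identity. *)
Lemma eigenstate_sgn_mean (p : pauli) :
  \sum_b (2^-1 * sgn p b)%:C *: eigenstate (basis p) b = 2^-1 *: mx p.
Proof.
rewrite /sgn /basis; case: eqP => [->|_].
  by rewrite mulr1 eigenstate_mean.
rewrite big_bool /= !rmorphM /= real_half -!scalerA -scalerDr; congr (_ *: _).
rewrite /eigenstate expr1 expr0 rmorphN1 rmorph1 scaleN1r !scale1r scaleN1r.
rewrite -scalerN -scalerDr opprB addrA subrK -mulr2n -[mx p *+ 2]scaler_nat scalerA.
by rewrite mulVf ?scale1r ?pnatr_eq0.
Qed.

(** The identity string is excluded because 2^-n (1 + 1) has trace 2. *)
Lemma corr_state_separable (n : nat) (o : option (pauli_string n)) :
  o != Some (id_string n) -> exists (p : {ffun 'I_n -> bool} -> R) q,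
   [/\ forall e, 0 <= p e, \sum_e p e = 1, forall e k, density (q e k)
     & corr_state o = \sum_e (p e)%:C *: tens (q e)].
Proof.
move=> oI; set Q := odflt (id_string n) o.
(* Sample signs e with probability 2^-n (1 + prod_(k in supp Q) (-1)^(e k)) and
   prepare every qubit k in its eigenstate of sign e k. *)
pose cf k b := 2^-1 * sgn (Q k) b.
(* Without a target string the signs are uniform. *)
pose w (e : {ffun 'I_n -> bool}) := if o then \prod_k cf k (e k) else 0.
pose q (e : {ffun 'I_n -> bool}) k := eigenstate (basis (Q k)) (e k).
(* Product weights let the sum over sign patterns factor site by site. *)
have splitprod (F : 'I_n -> bool -> R) :
    \sum_(e : {ffun 'I_n -> bool}) (\prod_k F k (e k))%:C *: tens (q e)
    = tens (fun k => \sum_b (F k b)%:C *: eigenstate (basis (Q k)) b).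
  by rewrite tens_sum; apply: eq_bigr => e _; rewrite [RHS]tens_scale rmorph_prod.
exists (fun e => \prod_(k < n) 2^-1 + w e), q; split.
- move=> e; rewrite /w; case: (isSome o); last first.
    by rewrite addr0 prodr_ge0 // => k _; rewrite invr_ge0 ler0n.
  (* Each factor has modulus 1/2, so the signed term is at least -2^-n. *)
  rewrite -lerBlDr sub0r (le_trans (ler_norm _)) // normrN normr_prod.
  apply: ler_prod => k _; rewrite normr_ge0 /cf normrM /sgn.
  rewrite ger0_norm ?invr_ge0 ?ler0n //.
  by case: ifP => _; rewrite ?normr1 ?normr_sign mulr1 lexx.
- rewrite big_split sumr_const card_ffun card_bool card_ord /=.
  rewrite prodr_const card_ord -[_ *+ (2 ^ n)%N]mulr_natr natrX -exprMn.
  rewrite mulVf ?pnatr_eq0 // expr1n -[RHS]addr0; congr (_ + _).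
  have [oS|oN] := boolP (isSome o); last by rewrite /w (negPf oN) big1.
  rewrite /w oS -(bigA_distr_bigA cf).
  (* A site where Q is nontrivial contributes the factor 1/2 - 1/2 = 0. *)
  have [k nek] : exists k, Q k != PI.
    apply/existsP; apply: contraNT oI => /existsPn eqQ.
    rewrite (_ : o = Some Q); last by rewrite /Q; case: (o) oS.
    apply/eqP; congr Some; apply/ffunP => k; apply/eqP.
    by move: (eqQ k); rewrite negbK ffunE.
  rewrite (bigD1 k) //= big_bool /cf /sgn (negPf nek) /= expr1 expr0.
  by rewrite -mulrDr addNr mulr0 mul0r.
- move=> e k; apply: eigenstate_density.
  by rewrite /basis; case: ifP => // /negbT.
under eq_bigr do rewrite rmorphD scalerDl /=.
have halfC : (2^-1) ^+ n = \prod_(k < n) 2^-1 :> C.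
  by rewrite prodr_const card_ord.
rewrite big_split /= /corr_state scalerDr halfC; congr (_ + _).
  rewrite -tens_scale (splitprod (fun _ _ => 2^-1)); apply: eq_tens => k.
  by rewrite ffunE eigenstate_mean.
rewrite /w; case: (o) @Q @cf @w @q splitprod {oI} => [P|] Q cf w q splitprod /=.
  by rewrite (splitprod cf) -tens_scale; apply: eq_tens => k;
    rewrite eigenstate_sgn_mean.
by rewrite scaler0 big1 // => e _; rewrite rmorph0 scale0r.
Qed.

(** * Probes and their local entries *)

Definition probe (n : nat) (F : 'I_n -> option (pauli_string n)) :
    'M[C]_(hdim n) :=
  \sum_k (n%:R^-1)%:C *: corr_state (F k).

(** A mixture of mixtures is a mixture over pairs of a site and a sign pattern. *)
Lemma probe_separable (n : nat) (F : 'I_n -> option (pauli_string n)) :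
  (0 < n)%N -> (forall k, F k != Some (id_string n)) -> separable (probe F).
Proof.
move=> n0 FI.
have /fin_all_exists[p hp] k := corr_state_separable (FI k).
have [q hq] := fin_all_exists hp.
have -> : probe F = \sum_(ke : 'I_n * {ffun 'I_n -> bool})
    (n%:R^-1 * p ke.1 ke.2)%:C *: tens (q ke.1 ke.2).
  rewrite -(pair_bigA _ (fun k e => (n%:R^-1 * p k e)%:C *: tens (q k e))) /=.
  apply: eq_bigr => k _; case: (hq k) => _ _ _ ->; rewrite scaler_sumr.
  by apply: eq_bigr => e _; rewrite rmorphM scalerA.
apply: (separable_sum (p := fun ke => n%:R^-1 * p ke.1 ke.2)).
- by move=> [k e]; case: (hq k) => p0 _ _ _; rewrite mulr_ge0 ?invr_ge0 ?ler0n.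
- rewrite -(pair_bigA _ (fun k e => n%:R^-1 * p k e)) /=.
  under eq_bigr => k _ do
    (rewrite -mulr_sumr; case: (hq k) => _ -> _ _; rewrite mulr1).
  by rewrite sumr_const card_ord -[_ *+ n]mulr_natr mulVf // pnatr_eq0 -lt0n.
by move=> [k e] i; case: (hq k).
Qed.

(** Twice the imaginary part of [Zphase p]. *)
Definition Zweight (p : pauli) : R :=
  match p with PX => 2 | PY => -2 | _ => 0 end.

Lemma ZweightE (p : pauli) :
  - 'i * (Zphase p - (Zphase p)^*%C) = (Zweight p)%:C.
Proof.
by case: p; rewrite /Zphase /Zweight; apply/eqP; rewrite eq_complex /=;
  apply/andP; split; apply/eqP; ring.
Qed.

Lemma local_entry_probe (n : nat) (j : 'I_n) (P : pauli_string n) F :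
  flips (P j) ->
  local_entry j P (probe F)
  = (Zweight (P j) / n%:R * \sum_k (F k == Some (mulZ_at j P))%:R)%:C.
Proof.
move=> Pj; rewrite /local_entry commutator_Zop -scalemxAl mxtraceZ mulrA ZweightE.
rewrite -[in RHS]mulrA rmorphM; congr (_ * _).
rewrite mulmx_sumr raddf_sum /= mulr_sumr rmorph_sum; apply: eq_bigr => k _.
rewrite -scalemxAr mxtraceZ tr_corr_state ?rmorphM ?rmorph_nat //.
(* The exchanged string still has x or y at site j, so it is not the identity. *)
apply: contraTneq Pj => /ffunP/(_ j); rewrite !ffunE eqxx.
by case: (P j).
Qed.

End Quantum.

(** * Solvability from an optimal coloring *)

Theorem proposition1 (R : realType) (n : nat) (hn : (0 < n)%N)
  (r : nat) (W : 'I_r -> pauli_string n)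
  (W_distinct : injective W)
  (W_nonid : forall m, W m <> id_string n) :
  exists (S : nat) (rho : 'I_S -> 'M[R[i]]_(hdim n)),
    [/\ injective rho,
        forall s, separable (rho s),
        (S <= chromatic_number (nbhd_graph R W) * alpha_loc R W)%N
      & forall j : 'I_n, locally_solvable W rho j].
Proof.
set chi := chromatic_number _; set alpha := alpha_loc R W.
have [c col] : exists c, @proper_coloring _ (nbhd_graph R W) chi c.
  by apply/existsP; rewrite /chi /chromatic_number; case: ex_minnP.
pose N := active_nbhd R W.
(* [onth] returns [None] once t reaches the size of N(k). *)
pose F (a : 'I_chi) (t : nat) k :=
  if c k == a then omap (mulZ_at k) (onth (enum (N k)) t) else None.
have F_supp a t k P : F a t k = Some P ->
    [/\ c k = a, k \in supp P & supp P \subset nbhd_supp R W k].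
  rewrite /F; case: eqP => // ca; case E: onth => [Q|] //= [<-].
  have QN : Q \in N k by rewrite -mem_enum; apply/onthP; exists t.
  have Qk := active_flips QN.
  split=> //; rewrite supp_mulZ_at //; last exact: (bigcup_sup Q).
  by rewrite inE; case: (Q k) Qk.
(* Distinct pairs (a, t) may give the same probe. *)
pose l := undup [seq probe R (F s.1 s.2) | s : 'I_chi * 'I_alpha].
exists (size l), (tnth (in_tuple l)); split.
- by apply/tuple_uniqP/undup_uniq.
- move=> s; have := mem_tnth s (in_tuple l).
  rewrite mem_undup => /imageP[[a t] _ ->] /=.
  apply: probe_separable => // k; apply/eqP => /F_supp[_ + _].
  by rewrite inE ffunE.
- by rewrite (leq_trans (size_undup _)) // size_image card_prod !card_ord.
move=> j; apply/eqP/row_full_diag => m.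
(* The probe of color [c j] and index m isolates column m; it is in the list since m < |N(j)| <=
   [alpha]. *)
have m_alpha : (m < alpha)%N.
  by rewrite (leq_trans (ltn_ord m)) // (leq_bigmax j).
have /tnthP[s /esym ls] : probe R (F (c j) m) \in in_tuple l.
  by rewrite mem_undup; apply/imageP; exists (c j, Ordinal m_alpha).
pose w (i : 'I_#|N j|) := Zweight R (enum_val i j) / n%:R.
have flips_val i : flips (enum_val (i : 'I_#|N j|) j).
  by apply: active_flips; apply: enum_valP.
exists s, (w m); split.
  rewrite mulf_neq0 ?invr_eq0 ?pnatr_eq0 -?lt0n //.
  by case: (enum_val m j) (flips_val m) => // _; rewrite ?oppr_eq0 pnatr_eq0.
apply/rowP => i; rewrite !mxE ls local_entry_probe // eqxx /=.
rewrite (bigD1 j) //= big1 ?addr0; last first.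
  (* If another site k of this color had the same target, j would lie in both neighborhood supports,
     making k and j adjacent. *)
  move=> k kj; case: eqP => // /F_supp[ckj _ /subsetP sPk].
  have Nj := flips_val i.
  have jk : j \in nbhd_supp R W k.
    by apply: sPk; rewrite supp_mulZ_at // inE; case: (enum_val i j) Nj.
  have jj : j \in nbhd_supp R W j.
    apply/bigcupP; exists (enum_val i); first exact: enum_valP.
    by rewrite inE; case: (enum_val i j) Nj.
  have kj_adj : nbhd_graph R W k j.
    apply/andP; split; first exact: kj.
    apply/set0Pn; exists j; apply/setIP; exact: (conj jk jj).
  move/forallP/(_ k)/forallP/(_ j)/implyP/(_ kj_adj): col.
  by rewrite ckj eqxx.
have -> : F (c j) m j = Some (mulZ_at j (enum_val m)).
  rewrite /F eqxx onthE (nth_map (id_string n)) -?cardE //=.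
  by rewrite -enum_val_nth.
(* The exchange at j is injective, being an involution, so the remaining indicator is that of i =
   m. *)
rewrite (inj_eq (@Some_inj _)) (inj_eq (can_inj (mulZ_atK _))).
rewrite (inj_eq enum_val_inj) [m == i]eq_sym.
by case: eqP => [->|_]; rewrite ?mulr1 ?mulr0.
Qed.
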